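(* For every integer $q\geq 1$, the symmetric group $\mathcal{S}_3$ of degree $3$ has a faithful representation by Riordan arrays over the Galois field $\mathbb{GF}(3^q)$ with $3^q$ elements; that is, there exists an injective group homomorphism $\mathcal{S}_3\to\mathcal{R}(\mathbb{GF}(3^q))$.
   Context: Riordan group: for a field $\mathbb{K}$, $\mathcal{R}(\mathbb{K})$ is the set of pairs $(g(t),f(t))$ (Riordan arrays) of formal power series in $\mathbb{K}[[t]]$ with $g(0)\neq 0$, $f(0)=0$ and $f'(0)\neq 0$, with group operation $(g_1(t),f_1(t))*(g_2(t),f_2(t))=(g_1(t)\,g_2(f_1(t)),\,f_2(f_1(t)))$ and identity $(1,t)$. The pair $(g,f)$ is identified with the infinite lower triangular matrix with entries $a_{n,k}=[t^n]\,g(t)f(t)^k$, $n,k\geq 0$, and the operation corresponds to matrix multiplication. *)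

(* Defs.v *)
(* The classical axioms of [boolp] provide function extensionality and
   the eqType/choiceType structures on power series. *)
From HB Require Import structures.
From mathcomp Require Import all_boot all_order all_algebra all_fingroup.
From mathcomp Require Import boolp zify.

Set Implicit Arguments.
Unset Strict Implicit.
Unset Printing Implicit Defensive.

Import GRing.Theory.
Local Open Scope ring_scope.

Record fps (K : Type) := Fps { fps_coef :> nat -> K }.

HB.instance Definition _ (K : Type) := gen_eqMixin (fps K).
HB.instance Definition _ (K : Type) := gen_choiceMixin (fps K).

Lemma fpsP (K : Type) (a b : fps K) : (forall n, a n = b n) <-> a = b.
Proof.
split=> [|-> //]; case: a b => [a] [b] /= ab.
by congr Fps; apply/funext.
Qed.

Section FpsRing.
Variable K : comNzRingType.
Implicit Types (a b c f g : fps K) (p q : {poly K}).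

Definition fps_zero : fps K := Fps (fun=> 0).
Definition fps_one : fps K := Fps (fun n => (n == 0%N)%:R).
Definition fps_opp a : fps K := Fps (fun n => - a n).
Definition fps_add a b : fps K := Fps (fun n => a n + b n).
Definition fps_mul a b : fps K :=
  Fps (fun n => \sum_(j < n.+1) a j * b (n - j)%N).

Fact fps_addA : associative fps_add.
Proof. by move=> a b c; apply/fpsP=> n; apply: addrA. Qed.
Fact fps_addC : commutative fps_add.
Proof. by move=> a b; apply/fpsP=> n; apply: addrC. Qed.
Fact fps_add0 : left_id fps_zero fps_add.
Proof. by move=> a; apply/fpsP=> n; apply: add0r. Qed.
Fact fps_addN : left_inverse fps_zero fps_opp fps_add.
Proof. by move=> a; apply/fpsP=> n; apply: addNr. Qed.

HB.instance Definition _ := GRing.isZmodule.Build (fps K)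
  fps_addA fps_addC fps_add0 fps_addN.

(* [agree N a p]: a = p modulo t^(N+1); this transfers identities from {poly K}. *)
Let agree (N : nat) a p := forall n, (n <= N)%N -> a n = p`_n.

Let trunc (N : nat) a : {poly K} := \poly_(i < N.+1) a i.

Let agree_trunc N a : agree N a (trunc N a).
Proof. by move=> n nN; rewrite coef_poly ltnS nN. Qed.

Let agree_add N a b p q :
  agree N a p -> agree N b q -> agree N (fps_add a b) (p + q).
Proof. by move=> ap bq n nN; rewrite coefD -ap // -bq. Qed.

Let agree_mul N a b p q :
  agree N a p -> agree N b q -> agree N (fps_mul a b) (p * q).
Proof.
move=> ap bq n nN; rewrite coefM; apply: eq_bigr => -[j /= jn] _.
by rewrite ap 1?bq // ?(leq_trans _ nN) // leq_subr.
Qed.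

Let agree_one N : agree N fps_one 1.
Proof. by move=> n _; rewrite coef1. Qed.

Let agree_eq a b :
  (forall N, exists p, agree N a p /\ agree N b p) -> a = b.
Proof. by move=> ab; apply/fpsP=> n; have [p [ap bp]] := ab n; rewrite ap ?bp. Qed.

Fact fps_mulA : associative fps_mul.
Proof.
move=> a b c; apply: agree_eq => N.
exists (trunc N a * (trunc N b * trunc N c)); split; last rewrite mulrA;
  by do !apply: agree_mul.
Qed.
Fact fps_mulC : commutative fps_mul.
Proof.
move=> a b; apply: agree_eq => N.
by exists (trunc N a * trunc N b); split; last rewrite mulrC; apply: agree_mul.
Qed.
Fact fps_mul1 : left_id fps_one fps_mul.
Proof.
move=> a; apply: agree_eq => N.
by exists (1 * trunc N a); split; [apply: agree_mul | rewrite mul1r].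
Qed.
Fact fps_mulDl : left_distributive fps_mul fps_add.
Proof.
move=> a b c; apply: agree_eq => N.
exists ((trunc N a + trunc N b) * trunc N c); split; last rewrite mulrDl.
  by apply: agree_mul => //; apply: agree_add.
by apply: agree_add; apply: agree_mul.
Qed.
Fact fps_one_neq0 : fps_one != 0 :> fps K.
Proof.
by apply/eqP=> /fpsP/(_ 0%N)/= /eqP; rewrite (negPf (oner_neq0 _)).
Qed.

HB.instance Definition _ := GRing.Zmodule_isComNzRing.Build (fps K)
  fps_mulA fps_mulC fps_mul1 fps_mulDl fps_one_neq0.

Definition fpsX : fps K := Fps (fun n => (n == 1%N)%:R).

Definition fps_deriv a : fps K := Fps (fun n => a n.+1 *+ n.+1).

(* The substitution a(f(t)), meaningful when f(0) = 0: then f^k is a multiple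
   of t^k, so that the sum over all k reduces to k <= n. *)
Definition fps_comp a f : fps K :=
  Fps (fun n => \sum_(k < n.+1) a k * (f ^+ k) n).

Lemma coef_fps1 n : (1 : fps K) n = (n == 0%N)%:R. Proof. by []. Qed.

Lemma coef_fpsM a b n : (a * b) n = \sum_(j < n.+1) a j * b (n - j)%N.
Proof. by []. Qed.

Lemma fps_coef0M a b : (a * b) 0%N = a 0%N * b 0%N.
Proof. by rewrite coef_fpsM big_ord1. Qed.

Lemma coef_fps_exp_lt f k n : f 0%N = 0 -> (n < k)%N -> (f ^+ k) n = 0.
Proof.
move=> f0; elim: k n => [//|k IHk] n nk.
rewrite exprS coef_fpsM big1 // => -[[|j] /= jn] _; first by rewrite f0 mul0r.
by rewrite IHk ?mulr0 //; lia.
Qed.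

Lemma coef_fps_exp_diag f k : f 0%N = 0 -> (f ^+ k) k = (f 1%N) ^+ k.
Proof.
move=> f0; elim: k => [|k IHk]; first by rewrite !expr0 coef_fps1.
rewrite !exprS coef_fpsM !big_ord_recl /= f0 mul0r add0r subSS subn0 IHk.
rewrite big1 ?addr0 // => -[j /= jk] _; rewrite coef_fps_exp_lt ?mulr0 //=.
by rewrite /bump; lia.
Qed.

Let agree_exp N a p k : agree N a p -> agree N (a ^+ k) (p ^+ k).
Proof.
by move=> ap; elim: k => [|k IHk]; [apply: agree_one | rewrite !exprS; apply: agree_mul].
Qed.

Let agree_comp N a f p q : f 0%N = 0 ->
  agree N a p -> agree N f q -> agree N (fps_comp a f) (p \Po q).
Proof.
move=> f0 ap fq n nN; rewrite coef_comp_poly.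
pose F k := p`_k * (f ^+ k) n; pose M := maxn n.+1 (size p).
transitivity (\sum_(k < M) F k).
  rewrite /= (@big_ord_widen _ _ _ n.+1 M (fun k => a k * (f ^+ k) n)) ?leq_maxl // big_mkcond.
  apply: eq_bigr => k _; case: ltnP => [kn|nk]; last first.
    by rewrite /F coef_fps_exp_lt ?mulr0.
  by rewrite ap // (leq_trans _ nN).
transitivity (\sum_(k < size p) F k).
  rewrite [RHS](@big_ord_widen _ _ _ _ M) ?leq_maxr // [RHS]big_mkcond.
  apply: eq_bigr => k _; case: ltnP => // pk.
  by rewrite /F nth_default ?mul0r.
by apply: eq_bigr => k _; rewrite /F (agree_exp _ fq).
Qed.

Lemma fps_comp_coef0 a f : (fps_comp a f) 0%N = a 0%N.
Proof. by rewrite /= big_ord1 expr0 mulr1. Qed.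

Lemma fps_comp_coef1 a f : f 0%N = 0 -> (fps_comp a f) 1%N = a 1%N * f 1%N.
Proof.
by move=> f0; rewrite /= !big_ord_recl big_ord0 /= mulr0 add0r addr0.
Qed.

Lemma fps_comp1 f : fps_comp 1 f = 1.
Proof.
apply/fpsP=> n; rewrite /= big_ord_recl big1 ?addr0 => [|i _].
  by rewrite mul1r expr0.
by rewrite mul0r.
Qed.

Lemma fps_compX f : f 0%N = 0 -> fps_comp fpsX f = f.
Proof.
move=> f0; apply/fpsP=> -[|n]; first by rewrite fps_comp_coef0 f0.
rewrite /= !big_ord_recl /= mul0r add0r mul1r expr1 big1 ?addr0 // => i _.
by rewrite mul0r.
Qed.

Lemma fps_compXr a : fps_comp a fpsX = a.
Proof.
apply: agree_eq => N; exists (trunc N a \Po 'X).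
by split; [apply: agree_comp => // n _; rewrite coefX | rewrite comp_polyXr].
Qed.

Lemma fps_compM a b f : f 0%N = 0 ->
  fps_comp (a * b) f = fps_comp a f * fps_comp b f.
Proof.
move=> f0; apply: agree_eq => N.
exists ((trunc N a * trunc N b) \Po trunc N f); split.
  by apply: agree_comp => //; apply: agree_mul.
by rewrite comp_polyM; apply: agree_mul; apply: agree_comp.
Qed.

Lemma fps_compA a f g : f 0%N = 0 -> g 0%N = 0 ->
  fps_comp (fps_comp a f) g = fps_comp a (fps_comp f g).
Proof.
move=> f0 g0; apply: agree_eq => N.
exists (trunc N a \Po (trunc N f \Po trunc N g)); split.
  by rewrite comp_polyA; do !apply: agree_comp.
by do !apply: agree_comp; rewrite // fps_comp_coef0.
Qed.

Lemma coef_fpsM_comp a b f n : f 0%N = 0 ->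
  (b * fps_comp a f) n = \sum_(k < n.+1) (b * f ^+ k) n * a k.
Proof.
move=> f0; rewrite coef_fpsM.
under [RHS]eq_bigr do rewrite coef_fpsM mulr_suml.
rewrite exchange_big /=; apply: eq_bigr => -[j /= jn] _.
rewrite /= (@big_ord_widen _ _ _ _ n.+1 (fun k => a k * (f ^+ k) (n - j)%N)) ?ltnS ?leq_subr //.
rewrite big_mkcond mulr_sumr; apply: eq_bigr => k _; case: ltnP => [_|jk].
  by rewrite -mulrA; congr (_ * _); apply: mulrC.
by rewrite coef_fps_exp_lt // !mulr0 mul0r.
Qed.

End FpsRing.

Section TriangularSystem.
Variables (K : fieldType) (A : nat -> nat -> K) (e : fps K).

Fixpoint trisolve_seq (n : nat) : seq K :=
  if n is m.+1 then
    let s := trisolve_seq m in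
    rcons s ((e m - \sum_(k < m) A m k * s`_k) / A m m)
  else [::].

(* Forward substitution for the lower triangular system A h = e. *)
Definition trisolve : fps K := Fps (fun n => (trisolve_seq n.+1)`_n).

Lemma trisolveP (n : nat) : (forall m, A m m != 0) ->
  \sum_(k < n.+1) A n k * trisolve k = e n.
Proof.
have sz m : size (trisolve_seq m) = m by elim: m => //= m IHm; rewrite size_rcons IHm.
have st m k : (k < m)%N -> (trisolve_seq m)`_k = trisolve k.
  elim: m => [//|m IHm]; rewrite ltnS leq_eqVlt => /orP[/eqP-> //|km].
  by rewrite -IHm //= nth_rcons sz km.
move=> A0; rewrite big_ord_recr /= nth_rcons sz ltnn eqxx.
under eq_bigr do rewrite -/(trisolve_seq _.+1) -/(fps_coef trisolve _).
under [X in _ - X]eq_bigr do rewrite st //.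
by rewrite mulrC divfK ?A0 // addrC subrK.
Qed.

End TriangularSystem.

Definition is_riordan (K : fieldType) (r : fps K * fps K) : bool :=
  [&& r.1 0%N != 0, r.2 0%N == 0 & fps_deriv r.2 0%N != 0].

Record riordan (K : fieldType) := Riordan {
  riordan_pair :> fps K * fps K;
  riordanP : is_riordan riordan_pair
}.

HB.instance Definition _ (K : fieldType) := [isSub for @riordan_pair K].
HB.instance Definition _ (K : fieldType) := [Choice of riordan K by <:].

Section RiordanGroup.
Variable K : fieldType.
Implicit Types r s : riordan K.

Lemma riordan1N0 r : r.1 0%N != 0. Proof. by case/and3P: (riordanP r). Qed.
Lemma riordan20 r : r.2 0%N = 0. Proof. by case/and3P: (riordanP r) => _ /eqP. Qed.
Lemma riordan21N0 r : r.2 1%N != 0. Proof. by case/and3P: (riordanP r). Qed.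
#[local] Hint Resolve riordan1N0 riordan20 riordan21N0 : core.

Fact riordan_one_subproof : is_riordan (1 : fps K, fpsX K).
Proof. by rewrite /is_riordan /= oner_neq0 eqxx. Qed.
Definition riordan_one : riordan K := Riordan riordan_one_subproof.

Fact riordan_mul_subproof r s :
  is_riordan (r.1 * fps_comp s.1 r.2, fps_comp s.2 r.2).
Proof.
apply/and3P; split.
- by rewrite fps_coef0M fps_comp_coef0 mulf_neq0.
- by rewrite fps_comp_coef0 riordan20.
- by rewrite [X in X != _]fps_comp_coef1 ?mulf_neq0.
Qed.
Definition riordan_mul r s : riordan K := Riordan (riordan_mul_subproof r s).

Lemma riordan_diag r n : (r.1 * r.2 ^+ n) n != 0.
Proof.
rewrite coef_fpsM big_ord_recl big1 ?addr0 => [|[i /= iln] _].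
  by rewrite subn0 coef_fps_exp_diag // mulf_neq0 // expf_neq0.
by rewrite coef_fps_exp_lt ?mulr0 // /bump; lia.
Qed.

(* The solution (h, l) of g * h(f) = 1, l(f) = t for r = (g, f). *)
Let riordan_inv_pair r : fps K * fps K :=
  (trisolve (fun n k => (r.1 * r.2 ^+ k) n) 1,
   trisolve (fun n k => (r.2 ^+ k) n) (fpsX K)).

Let riordan_inv1 r : r.1 * fps_comp (riordan_inv_pair r).1 r.2 = 1.
Proof.
by apply/fpsP=> n; rewrite coef_fpsM_comp // trisolveP // => m; apply: riordan_diag.
Qed.

Let riordan_inv2 r : fps_comp (riordan_inv_pair r).2 r.2 = fpsX K.
Proof.
apply/fpsP=> n; rewrite -[fps_comp _ _]mul1r coef_fpsM_comp //.
under eq_bigr do rewrite mul1r.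
by rewrite trisolveP // => m; rewrite coef_fps_exp_diag // expf_neq0.
Qed.

Fact riordan_inv_subproof r : is_riordan (riordan_inv_pair r).
Proof.
have /fpsP/(_ 0%N) := riordan_inv1 r; rewrite fps_coef0M fps_comp_coef0 => e1.
have /fpsP/[dup]/(_ 0%N) := riordan_inv2 r; rewrite fps_comp_coef0 => e2 /(_ 1%N).
rewrite fps_comp_coef1 // => e3; apply/and3P; split; last 2 first.
- exact/eqP.
- apply/eqP=> h1; move: e3; rewrite -[_ 1%N]/(fps_deriv _ 0%N) h1 mul0r.
  by move/eqP; rewrite eq_sym oner_eq0.
- apply/eqP=> h0; move: e1; rewrite h0 mulr0.
  by move/eqP; rewrite eq_sym oner_eq0.
Qed.
Definition riordan_inv r : riordan K := Riordan (riordan_inv_subproof r).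

Fact riordan_mulA : associative riordan_mul.
Proof.
move=> r s u; apply/val_inj; rewrite /= fps_compM // mulrA.
by congr (_ * _, _); rewrite fps_compA.
Qed.
Fact riordan_mul1g : left_id riordan_one riordan_mul.
Proof. by move=> r; apply/val_inj; rewrite /= mul1r !fps_compXr -surjective_pairing. Qed.
Fact riordan_mulg1 : right_id riordan_one riordan_mul.
Proof.
by move=> r; apply/val_inj; rewrite /= fps_comp1 mulr1 fps_compX // -surjective_pairing.
Qed.
Fact riordan_mulgV : right_inverse riordan_one riordan_inv riordan_mul.
Proof. by move=> r; apply/val_inj; congr (_, _); [apply: riordan_inv1 | apply: riordan_inv2]. Qed.
Fact riordan_mulVg : left_inverse riordan_one riordan_inv riordan_mul.
Proof.
move=> r; rewrite -[LHS]riordan_mulg1 -[X in riordan_mul _ X](riordan_mulgV (riordan_inv r)).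
by rewrite -riordan_mulA [X in riordan_mul _ X]riordan_mulA riordan_mulgV
           riordan_mul1g riordan_mulgV.
Qed.

HB.instance Definition _ := isGroup.Build (riordan K)
  riordan_mulA riordan_mul1g riordan_mulg1 riordan_mulVg riordan_mulgV.

Lemma riordan_mulE r s :
  riordan_pair (r * s)%g = (r.1 * fps_comp s.1 r.2, fps_comp s.2 r.2).
Proof. by []. Qed.

Lemma riordan_oneE : riordan_pair (1%g : riordan K) = (1, fpsX K).
Proof. by []. Qed.

(* The infinite lower triangular matrix identified with the pair (g, f). *)
Definition riordan_entry r (n k : nat) : K := (r.1 * r.2 ^+ k) n.

Lemma riordan_entry_trig r n k : (n < k)%N -> riordan_entry r n k = 0.
Proof.
move=> nk; rewrite /riordan_entry coef_fpsM big1 // => -[j /= jn] _.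
by rewrite coef_fps_exp_lt ?mulr0 //; lia.
Qed.

Lemma riordan_entryM r s n k :
  riordan_entry (r * s)%g n k =
  \sum_(j < n.+1) riordan_entry r n j * riordan_entry s j k.
Proof.
rewrite /riordan_entry -(coef_fpsM_comp (s.1 * s.2 ^+ k) r.1) // riordan_mulE.
rewrite -[(_, _).1]/(r.1 * fps_comp s.1 r.2) -[(_, _).2]/(fps_comp s.2 r.2).
have -> : fps_comp s.2 r.2 ^+ k = fps_comp (s.2 ^+ k) r.2.
  by elim: k => [|k IHk]; rewrite ?expr0 ?fps_comp1 // !exprS IHk fps_compM.
by rewrite fps_compM // mulrA.
Qed.

Lemma riordan_entry_inj r s : riordan_entry r =2 riordan_entry s -> r = s.
Proof.
move=> rs; have e1 : r.1 = s.1.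
  by apply/fpsP=> n; have := rs n 0%N; rewrite /riordan_entry !expr0 !mulr1.
have e2 : r.1 * r.2 = r.1 * s.2.
  by apply/fpsP=> n; have := rs n 1%N; rewrite /riordan_entry !expr1 -e1.
apply/val_inj; rewrite /= (surjective_pairing r) (surjective_pairing s) e1.
have /(congr1 ( *%R (fps_comp (riordan_inv r).1 r.2))) := e2.
by rewrite !mulrA ![_ * r.1]mulrC riordan_inv1 !mul1r => ->.
Qed.

End RiordanGroup.

(* Main.v *)
(* S_3 is the affine group of Z/3Z, and the substitution u = 1/t turns the affine
   map u |-> a u + c into the power series t / (a + c t); in characteristic 3
   this embeds S_3 among the Riordan arrays of the form (1, f). *)
Require Import Defs.
From mathcomp Require Import all_boot all_order all_algebra all_fingroup.
From HB Require Import structures.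
From mathcomp Require Import finfield ring.

Set Implicit Arguments.
Unset Strict Implicit.
Unset Printing Implicit Defensive.

Import GRing.Theory.
Local Open Scope ring_scope.

Section Constants.
Variable K : comNzRingType.
Implicit Types (a c : K) (f g h : fps K).

Definition fpsC a : fps K := Fps (fun n => a *+ (n == 0%N)).

Lemma coef_fpsCM a f n : (fpsC a * f) n = a * f n.
Proof.
rewrite coef_fpsM big_ord_recl big1 ?addr0 ?subn0 // => i _.
by rewrite mul0r.
Qed.

Lemma coef_fpsXM f n : (fpsX K * f) n.+1 = f n.
Proof.
rewrite coef_fpsM !big_ord_recl big1 => [|i _]; last by rewrite mul0r.
by rewrite /= mul0r add0r addr0 mul1r subn1.
Qed.

Lemma fpsCD a c : fpsC (a + c) = fpsC a + fpsC c.
Proof. by apply/fpsP=> n; rewrite /= mulrnDl. Qed.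

Lemma fpsCM a c : fpsC (a * c) = fpsC a * fpsC c.
Proof. by apply/fpsP=> n; rewrite coef_fpsCM /= mulrnAr. Qed.

Lemma fps_compD f g h : fps_comp (f + g) h = fps_comp f h + fps_comp g h.
Proof.
by apply/fpsP=> n; rewrite /= -big_split; apply: eq_bigr => i _; rewrite mulrDl.
Qed.

Lemma fps_compC a f : fps_comp (fpsC a) f = fpsC a.
Proof.
apply/fpsP=> n; rewrite /= big_ord_recl big1 => [|i _]; last by rewrite mul0r.
by rewrite addr0 expr0 coef_fps1 mulr_natr.
Qed.

End Constants.

Section Moebius.
Variable K : fieldType.
Implicit Types a c : K.

Let denom a c : fps K := fpsC a + fpsC c * fpsX K.

(** The geometric series for 1 / (a + c t), whose ratio is - (c / a) t. *)
Let denom_inv a c : fps K := Fps (fun n => a^-1 * (- c / a) ^+ n).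

Let denomK a c : a != 0 -> denom a c * denom_inv a c = 1.
Proof.
move=> a0; apply/fpsP=> n; rewrite mulrDl -mulrA.
rewrite -[LHS]/((fpsC a * _) n + (fpsC c * _) n) !coef_fpsCM.
case: n => [|n]; rewrite coef_fps1.
  by rewrite fps_coef0M /= mul0r mulr0 addr0 mulr1 divff.
by rewrite coef_fpsXM /= exprS; field.
Qed.

(* The expansion of t / (a + c t). *)
Definition moebius a c : fps K := fpsX K * denom_inv a c.

Lemma moebius0 a c : moebius a c 0%N = 0.
Proof. by rewrite fps_coef0M mul0r. Qed.

Lemma moebius1 a c : moebius a c 1%N = a^-1.
Proof. by rewrite coef_fpsXM /= mulr1. Qed.

Lemma moebius2 a c : moebius a c 2%N = a^-1 * (- c / a).
Proof. by rewrite coef_fpsXM. Qed.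

(** The coefficients of t and t^2 are 1 / a and - c / a^2; the first determines a, and then the
    second determines c. *)
Lemma moebius_inj a c b d : a != 0 ->
  moebius a c = moebius b d -> a = b /\ c = d.
Proof.
move=> a0 /fpsP e; have := e 1%N; rewrite !moebius1 => /invr_inj ab.
split=> //; have := e 2%N; rewrite !moebius2 -ab => /(mulfI (invr_neq0 a0)).
by move/(mulIf (invr_neq0 a0))/oppr_inj.
Qed.

(** In the coordinate u = 1/t this is b (a u + c) + d = (a b) u + (b c + d), with the inner map
    applied first. *)
Lemma moebius_comp a c b d : a != 0 -> b != 0 ->
  fps_comp (moebius b d) (moebius a c) = moebius (a * b) (b * c + d).
Proof.
move=> a0 b0; set f := moebius a c; set h := fps_comp _ _.
have f0 : f 0%N = 0 by apply: moebius0.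
have df : denom a c * f = fpsX K by rewrite mulrCA denomK // mulr1.
(* Substitute f for t in (b + d t) * (t / (b + d t)) = t. *)
have dh : (fpsC b + fpsC d * f) * h = f.
  rewrite -{1}(fps_compX f0) -(fps_compC b f) -(fps_compC d f) -fps_compM //.
  by rewrite -fps_compD -fps_compM // mulrCA denomK // mulr1 fps_compX.
(* By [df], multiplying b + d f by a + c t clears the denominator of f, so h solves the equation
   that defines the right-hand series. *)
have e : denom (a * b) (b * c + d) * h = fpsX K.
  have -> : denom (a * b) (b * c + d) = denom a c * (fpsC b + fpsC d * f).
    by rewrite mulrDr [_ * (fpsC d * f)]mulrCA df /denom fpsCD !fpsCM; ring.
  by rewrite -mulrA dh df.
by rewrite /moebius -[in RHS]e mulrAC denomK ?mul1r // mulf_neq0.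
Qed.

Lemma moebius_riordan a c : a != 0 -> is_riordan (1 : fps K, moebius a c).
Proof.
move=> a0; apply/and3P; split; first exact: oner_neq0.
  by rewrite moebius0.
by rewrite [X in X != _]moebius1 invr_neq0.
Qed.

End Moebius.

Section AffineS3.
Variables (F : fieldType) (char3 : 3 \in [pchar F]).
Implicit Types (i j : 'I_3) (s u : 'S_3).

Let residue i : F := (i : nat)%:R.

(** In characteristic 3, equal images force 3 to divide j - i, which lies between 0 and 2 once i <=
    j. *)
Let residue_inj : injective residue.
Proof.
move=> i j; wlog le_ij : i j / (i <= j)%N.
  by move=> H; case/orP: (leq_total i j) => le_ij /[dup] eij; [|move/esym];
    move/H => ->.
move/eqP; rewrite eq_sym -subr_eq0 -natrB // -(dvdn_pcharf char3) => dvd.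
apply/val_inj/eqP; rewrite eqn_leq le_ij -subn_eq0 /=.
by move: dvd (leq_ltn_trans (leq_subr i j) (ltn_ord j)); case: (j - i)%N => [|[|[|]]].
Qed.

Let i0 : 'I_3 := ord0.
Let i1 : 'I_3 := lift ord0 ord0.
Let i2 : 'I_3 := ord_max.

(** [translation] and [slope] are the coefficients of the affine map interpolating s at 0 and 1. *)
Let translation s : F := residue (s i0).
Let slope s : F := residue (s i1) - residue (s i0).

(* For i = 2 this says that the values of s sum to 0 + 1 + 2 = 0. *)
Let residue_perm s i : residue (s i) = slope s * residue i + translation s.
Proof.
have three0 : 3%:R = 0 :> F by apply: pcharf0.
have sum0 : residue (s i0) + residue (s i1) + residue (s i2) = 0.
  transitivity (\sum_j residue (s j)).
    rewrite !big_ord_recl big_ord0 addr0 addrA.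
    by congr (_ + residue (s _)); apply: val_inj.
  rewrite -(reindex_inj (@perm_inj _ s) (P := xpredT) (F := residue)) /=.
  by rewrite !big_ord_recl big_ord0 /residue /= addr0 add0r -natrD.
have [->|->|->] : [\/ i = i0, i = i1 | i = i2].
- by case: i => [[|[|[|]]] ?] //; [constructor 1|constructor 2|constructor 3]; apply: val_inj.
- by rewrite /residue mulr0 add0r.
- by rewrite /residue mulr1 subrK.
apply/eqP; rewrite -subr_eq0; apply/eqP.
(* The defect at 2 is s(2) - 2 s(1) + s(0), which is the sum of all values minus 3 s(1). *)
transitivity (residue (s i0) + residue (s i1) + residue (s i2)
              - 3%:R * residue (s i1)); last by rewrite sum0 three0 mul0r subr0.
by rewrite /slope /translation (_ : residue i2 = 2%:R) //; ring.
Qed.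

Let slope_neq0 s : slope s != 0.
Proof. by rewrite subr_eq0 (inj_eq residue_inj) (inj_eq perm_inj). Qed.

Definition riordan_of_perm s : riordan F :=
  Riordan (moebius_riordan (translation s) (slope_neq0 s)).

(** Both products let the left factor act first: [permM] evaluates u at the image under s, and the
    Riordan product substitutes the left series into the right one. Hence the order of factors is
    preserved. *)
Lemma riordan_of_permM : {morph riordan_of_perm : s u / (s * u)%g}.
Proof.
move=> s u; apply/val_inj; rewrite /= fps_comp1 mulr1 moebius_comp ?slope_neq0 //.
have translationM : translation (s * u)%g = slope u * translation s + translation u.
  by rewrite {1}/translation permM residue_perm.
congr (_, moebius _ _); last exact: translationM.
by rewrite {1}/slope !permM !(residue_perm u) [slope s]/slope; ring.
Qed.

(** The series determines slope and translation, hence by [residue_perm] the residue of every value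
    of the permutation. *)
Lemma riordan_of_perm_inj : injective riordan_of_perm.
Proof.
move=> s u /(congr1 (fun r : riordan F => r.2)).
case/(moebius_inj (slope_neq0 s)) => eslope etrans.
by apply/permP=> i; apply: residue_inj; rewrite !residue_perm eslope etrans.
Qed.

End AffineS3.

Theorem corollary8 (q : nat) (hq : (1 <= q)%N)
    (F : finFieldType) (hF : #|F| = (3 ^ q)%N) :
  exists phi : {multiplicative 'S_3 -> riordan F}, injective phi.
Proof.
have char3 : 3 \in [pchar F] by apply: card_finPcharP hF _.
pose phi := riordan_of_perm char3.
pose phi_mul := isMultiplicative.Build _ _ phi (riordan_of_permM char3).
pose Phi : {multiplicative 'S_3 -> riordan F} := HB.pack phi phi_mul.
by exists Phi; apply: riordan_of_perm_inj.
Qed.
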